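(* Let $\{S_\imath:\imath\in\mathcal{I}\}$ be an infinite collection of right cancellative semigroups, each having an identity element, with a given net $\mathcal{F}_\imath=\langle F_{\imath,j}\rangle_{j\in J_\imath}$ in $\mathcal{P}_f(S_\imath)$ for each $\imath\in\mathcal{I}$. Let $\mathcal{F}$ be the product net determined by $\{\mathcal{F}_\imath:\imath\in\mathcal{I}\}$. If $A_\imath$ is a $D$-set with respect to $\mathcal{F}_\imath$ in $S_\imath$ for each $\imath\in\mathcal{I}$, and $A_\imath$ is thick in $S_\imath$ for all but finitely many $\imath\in\mathcal{I}$, then $\prod_{\imath\in\mathcal{I}}A_\imath$ is a $D$-set with respect to $\mathcal{F}$ in $\prod_{\imath\in\mathcal{I}}S_\imath$.
   Context: Semigroups are nonempty and discrete; $\mathcal{P}_f(X)$ is the set of finite nonempty subsets of $X$; $\prod_\imath S_\imath$ is the Cartesian (direct) product semigroup. $\beta S$ is the space of ultrafilters on $S$ (Stone–Čech compactification), with basic open sets $\overline{A}=\{p\in\beta S: A\in p\}$ for $A\subseteq S$, and semigroup operation $pq=\{A\subseteq S:\{s\in S: s^{-1}A\in q\}\in p\}$, where $s^{-1}A=\{t\in S: st\in A\}$. For a net $\mathcal{F}=\langle F_i\rangle_{i\in I}$ in $\mathcal{P}_f(S)$ ($I$ a directed set) and $A\subseteq S$, the upper Banach density of $A$ with respect to $\mathcal{F}$ is $$d_{\mathcal{F}}^*(A)=\sup\{\alpha: (\forall i_0\in I)(\exists i\geq i_0)(\exists s\in S\cup\{1\})(|A\cap(F_i\cdot s)|\geq\alpha|F_i|)\},$$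 where $F_i\cdot 1$ means $F_i$. Put $D_{\mathcal{F}}^*=\{p\in\beta S:(\forall A\in p)(d_{\mathcal{F}}^*(A)>0)\}$. A subset $A\subseteq S$ is a $D$-set with respect to $\mathcal{F}$ if $A\in p$ for some idempotent $p$ ($pp=p$) of $\beta S$ with $p\in D_{\mathcal{F}}^*$. A subset $A$ of a semigroup $S$ is thick if for each $F\in\mathcal{P}_f(S)$ there exists $s\in S$ such that $Fs\subseteq A$. Product net of a family: let $\mathcal{F}_\imath=\langle F_{\imath,j}\rangle_{j\in J_\imath}$ be a net in $\mathcal{P}_f(S_\imath)$ for $\imath\in\mathcal{I}$, each $S_\imath$ having an identity $1$. Let $J_\imath'=J_\imath\cup\{1\}$, where $1$ is a point not in $J_\imath$, put $F_{\imath,1}=\{1\}$ (the identity), and specify $1\leq j$ for all $j\in J_\imath$. Let $\mathfrak{J}=\{\vec{j}\in\prod_{\imath\in\mathcal{I}}J_\imath':\{\imath\in\mathcal{I}: j(\imath)\neq 1\}\text{ is finite}\}$, ordered by $\vec{j}\leq\vec{k}$ iff $j(\imath)\leq k(\imath)$ for every $\imath\in\mathcal{I}$. The product net determined by $\{\mathcal{F}_\imath:\imath\in\mathcal{I}\}$ is $\mathcal{F}=\langle\prod_{\imath\in\mathcal{I}}F_{\imath,j(\imath)}\rangle_{\vec{j}\in\mathfrak{J}}$. *)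

(* Defs.v *)
From HB Require Import structures.
From mathcomp Require Import all_boot all_order all_algebra.
From mathcomp Require Import monoid finmap.
From mathcomp Require Import all_classical all_reals topology.

Set Implicit Arguments.
Unset Strict Implicit.
Unset Printing Implicit Defensive.

Import Order.TTheory GRing.Theory Num.Theory.
Local Open Scope classical_set_scope.
Local Open Scope ring_scope.

Definition right_cancellative (S : semigroupType) : Prop :=
  forall x y z : S, (x * z = y * z)%g -> x = y.

Section DirectProduct.
Variables (I : Type) (S : I -> monoidType).

Definition dprod_mul (x y : forall i, S i) : forall i, S i :=
  fun i => (x i * y i)%g.
Definition dprod_one : forall i, S i := fun i => 1%g.

Lemma dprod_mulA : associative dprod_mul.
Proof. by move=> x y z; apply: functional_extensionality_dep => i; exact: mulgA. Qed.
Lemma dprod_mul1g : left_id dprod_one dprod_mul.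
Proof. by move=> x; apply: functional_extensionality_dep => i; exact: mul1g. Qed.
Lemma dprod_mulg1 : right_id dprod_one dprod_mul.
Proof. by move=> x; apply: functional_extensionality_dep => i; exact: mulg1. Qed.

HB.instance Definition _ :=
  isMonoid.Build (forall i, S i) dprod_mulA dprod_mul1g dprod_mulg1.

End DirectProduct.

Definition Pf {X : Type} (F : set X) : Prop := finite_set F /\ F !=set0.

Structure Pf_net (S : Type) := PfNet {
  nidx :> Type;
  nle : nidx -> nidx -> Prop;
  nval : nidx -> set S;
  nidx_inhabited : inhabited nidx;
  nle_refl : forall i, nle i i;
  nle_trans : forall i j k, nle i j -> nle j k -> nle i k;
  nle_directed : forall i j, exists2 k, nle i k & nle j k;
  nval_Pf : forall i, Pf (nval i)
}.

Section Density.
Variables (R : realType) (S : semigroupType).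
Implicit Types (F : Pf_net S) (A : set S) (p q : set_system S).

(* S u {1} is [option S]: [None] is the formal identity. *)
Definition rtranslate (E : set S) (s : option S) : set S :=
  if s is Some t then [set (x * t)%g | x in E] else E.

(* The set contains 0 and, as the index type is inhabited and [nval i] is
   nonempty, is bounded above by 1, so [sup] is a genuine supremum. *)
Definition upper_banach_density F A : R :=
  sup [set a : R | forall i0 : F, exists2 i : F, nle i0 i &
    exists s : option S,
      a * #|` fset_set (nval i)|%:R
        <= #|` fset_set (A `&` rtranslate (nval i) s)|%:R].

Definition beta : set (set_system S) := [set p | UltraFilter p].

Definition beta_mul p q : set_system S :=
  [set A | p [set s | q [set t | A (s * t)%g]]].

Definition D_star F : set (set_system S) :=
  [set p | beta p /\ forall A, p A -> 0 < upper_banach_density F A].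

Definition D_set F A : Prop :=
  exists p, [/\ beta p, beta_mul p p = p, D_star F p & p A].

Definition thick A : Prop :=
  forall E, Pf E -> exists s : S, [set (x * s)%g | x in E] `<=` A.

End Density.

Section ProductNet.
Variables (I : Type) (S : I -> monoidType) (F : forall i, Pf_net (S i)).

(* J_i' = J_i u {1} is [option (F i)], with [None] the added least point 1. *)
Definition nle1 i (j k : option (F i)) : Prop :=
  match j, k with
  | None, _ => True
  | Some a, Some b => nle a b
  | Some _, None => False
  end.

Definition nval1 i (j : option (F i)) : set (S i) :=
  if j is Some a then nval a else [set 1%g].

Definition prod_idx : Type :=
  {j : forall i, option (F i) | finite_set [set i | j i <> None]}.

Definition prod_nle (j k : prod_idx) : Prop :=
  forall i, nle1 (sval j i) (sval k i).

Definition prod_nval (j : prod_idx) : set (forall i, S i) :=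
  [set x | forall i, nval1 (sval j i) (x i)].

Lemma prod_idx_inhabited : inhabited prod_idx.
Proof.
constructor; exists (fun i => None).
by rewrite (_ : [set i | _] = set0) //; apply/seteqP; split.
Qed.

Lemma prod_nle_refl j : prod_nle j j.
Proof. by move=> i; case: (sval j i) => //= a; exact: nle_refl. Qed.

Lemma prod_nle_trans j k l : prod_nle j k -> prod_nle k l -> prod_nle j l.
Proof.
move=> jk kl i; move: (jk i) (kl i); rewrite /nle1.
by case: (sval j i) (sval k i) (sval l i) => [a|] [b|] [c|] //; exact: nle_trans.
Qed.

Lemma prod_nle_directed j k : exists2 l, prod_nle j l & prod_nle k l.
Proof.
have ub i : exists l : option (F i), [/\ nle1 (sval j i) l, nle1 (sval k i) l &
    l <> None -> sval j i <> None \/ sval k i <> None].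
  case: (sval j i) (sval k i) => [a|] [b|].
  - by have [c ac bc] := nle_directed a b; exists (Some c); split=> //; left.
  - by exists (Some a); split=> //=; [exact: nle_refl|left].
  - by exists (Some b); split=> //=; [exact: nle_refl|right].
  - by exists None.
pose l i := sval (cid (ub i)).
have lP i : [/\ nle1 (sval j i) (l i), nle1 (sval k i) (l i) &
    l i <> None -> sval j i <> None \/ sval k i <> None] := svalP (cid (ub i)).
have lfin : finite_set [set i | l i <> None].
  apply: (@sub_finite_set _ _
    ([set i | sval j i <> None] `|` [set i | sval k i <> None])).
    by move=> i /=; case: (lP i).
  by rewrite finite_setU; split; [exact: (svalP j)|exact: (svalP k)].
by exists (exist _ l lfin) => i /=; case: (lP i).
Qed.

Lemma prod_nval_Pf j : Pf (prod_nval j).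
Proof.
have Pf1 i (a : option (F i)) : Pf (nval1 a).
  by case: a => [a|] /=; [exact: nval_Pf|split; [exact: finite_set1|exists 1%g]].
split; last first.
  pose x i := sval (cid (Pf1 i (sval j i)).2).
  by exists x => i; exact: svalP (cid (Pf1 i (sval j i)).2).
have [s sE] : exists s : seq {classic I}, [set i | sval j i <> None] = [set` s].
  by apply/(@finite_seqP {classic I}); exact: (svalP j).
pose B (r : seq {classic I}) : set (forall i, S i) := [set x | forall i : I,
  ((i : {classic I}) \in r -> nval1 (sval j i) (x i)) /\
  ((i : {classic I}) \notin r -> x i = 1%g)].
have Bfin r : finite_set (B r).
  elim: r => [|i r IH].
    apply: (@sub_finite_set _ _ [set 1%g]); last exact: finite_set1.
    move=> x xB; apply: functional_extensionality_dep => i.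
    by case: (xB i) => _ ->.
  case: (boolP (i \in r)) => [ir|nir].
    apply: sub_finite_set IH => x xB k; case: (xB k) => x1 x2; split => kr.
      by apply: x1; rewrite inE kr orbT.
    apply: x2; rewrite inE negb_or kr andbT.
    by apply: contraNneq kr => ->.
  pose upd (u : forall i, S i) (g : S i) : forall k, S k := fun k =>
    match pselect (i = k) with
    | left e => eq_rect i (fun k => S k : Type) g k e
    | right _ => u k
    end.
  have updN u g k : i <> k -> upd u g k = u k.
    by rewrite /upd; case: pselect.
  have updE u g : upd u g i = g.
    rewrite /upd; case: pselect => // e.
    by rewrite (Prop_irrelevance e erefl).
  have := finite_image2 upd IH (Pf1 i (sval j i)).1.
  apply: sub_finite_set => x xB.
  exists (upd x 1%g) => [k|]; last first.
    exists (x i); first by case: (xB i) => + _; apply; rewrite mem_head.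
    apply: functional_extensionality_dep => k.
    have [<-|ik] := pselect (i = k); first by rewrite updE.
    by rewrite !updN.
  have [<-|ik] := pselect (i = k).
    by rewrite updE; split => //; rewrite (negbTE nir).
  have ki : ((k : {classic I}) == i) = false by apply/eqP => ki; exact: ik.
  rewrite updN //; case: (xB k) => x1 x2; split => kr.
    by apply: x1; rewrite inE kr orbT.
  by apply: x2; rewrite inE ki.
apply: sub_finite_set (Bfin s) => x xj i; split => [_|]; first exact: xj.
move=> si; have := xj i; case ji : (sval j i) => [a|] //= _.
have : [set` s] i by rewrite -sE /= ji.
by rewrite /= (negbTE si).
Qed.

Definition product_net : Pf_net (forall i, S i) :=
  PfNet prod_idx_inhabited prod_nle_refl prod_nle_trans prod_nle_directed
    prod_nval_Pf.

End ProductNet.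

(* Main.v *)
(* By right cancellation, the ultrafilters consisting of sets of positive upper
   Banach density form a closed right ideal of the Stone-Cech compactification.
   Let [K] be the finite set of non-thick indices and [p i] an idempotent
   witnessing that [A i] is a D-set. The sets of those [y] with [y i] in a
   given member of [p i] for [i] in [K], and [x i * y i] in [A i] for [i]
   outside [K] and [x] in a given finite set, generate a filter whose refining
   ultrafilters form a closed subsemigroup: idempotency of [p i] handles the
   first condition, and the second one defines a left ideal. All these sets
   have positive density, so the subsemigroup meets the right ideal, and the
   Ellis-Numakura theorem yields an idempotent in the intersection. Its members
   include the product of the [A i], as one may take [x = 1]. *)
Require Import Defs.
From mathcomp Require Import all_boot all_order all_algebra.
From mathcomp Require Import monoid finmap.
From mathcomp Require Import all_classical all_reals.
From mathcomp Require Import ring lra.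

Set Implicit Arguments.
Unset Strict Implicit.
Unset Printing Implicit Defensive.

Import Order.TTheory GRing.Theory Num.Theory.
Local Open Scope classical_set_scope.
Local Open Scope ring_scope.

(** * Filters and the ultrafilters refining them *)

Lemma ultra_notin_setC T (p : set_system T) (A : set T) :
  UltraFilter p -> p (~` A) -> ~ p A.
Proof.
move=> pU pC pA; have [x []] := filter_ex (filterI pA pC).
by [].
Qed.

(** These [B] form the filter generated by [G] and the complement of [A]. *)
Lemma filter_setU_proper T (G : set_system T) (A : set T) :
  Filter G -> ~ G A -> ProperFilter [set B | G (A `|` B)].
Proof.
move=> GF nGA; apply: Build_ProperFilter; first by rewrite /= setU0.
split=> [|B C|B C BC] /=; first by rewrite setUT; exact: filterT.
- by rewrite setUIr; exact: filterI.
- by apply: filterS; exact: setUS.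
Qed.

(** Otherwise some ultrafilter would refine [G] and contain the complement of [A]. *)
Lemma filter_mem_ultra T (G : set_system T) (A : set T) : Filter G ->
  (forall p, UltraFilter p -> G `<=` p -> p A) -> G A.
Proof.
move=> GF GA; apply: contrapT => nGA.
have PG := filter_setU_proper GF nGA.
have [p [pU Gp]] := ultraFilterLemma PG.
apply: (@ultra_notin_setC _ p A) => //.
  by apply: Gp; rewrite /= setUv; exact: filterT.
by apply: GA => // B GB; apply: Gp; apply: filterS GB => x; right.
Qed.

(** * Ultrafilter multiplication and idempotents in closed subsemigroups *)

Section Ellis.
Variable S : semigroupType.
Implicit Types (A B : set S) (p q r G : set_system S).

Lemma beta_mul_proper p q :
  ProperFilter p -> ProperFilter q -> ProperFilter (beta_mul p q).
Proof.
move=> pP qP; apply: Build_ProperFilter.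
  by case/(@filter_ex _ p) => s /(@filter_ex _ q)[t].
split=> [|A B pA pB|A B AB]; rewrite /beta_mul /=.
- by apply: filterS filterT => s _; exact: filterT.
- by move: pA pB; apply: (@filterS2 _ p) => s; exact: filterI.
- by apply: filterS => s; apply: filterS => t; exact: AB.
Qed.

Lemma beta_mul_ultra p q :
  UltraFilter p -> UltraFilter q -> UltraFilter (beta_mul p q).
Proof.
move=> pU qU; split; first exact: beta_mul_proper.
move=> G GP pqG; apply/seteqP; split=> // A GA.
have [//|nA] := in_ultra_setVsetC [set s | q [set t | A (s * t)%g]] pU.
have /pqG GC : beta_mul p q (~` A).
  apply: filterS nA => s /= nqA.
  by have [|] := in_ultra_setVsetC [set t | A (s * t)%g] qU.
by have [x []] := filter_ex (filterI GA GC).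
Qed.

Lemma beta_mulA p q r : beta_mul p (beta_mul q r) = beta_mul (beta_mul p q) r.
Proof.
apply/funext => A; rewrite /beta_mul /=; congr (p _); apply/funext => s.
congr (q _); apply/funext => t /=; congr (r _); apply/funext => u /=.
by rewrite mulgA.
Qed.

(** This is $\{s : s^{-1}A\in p\}$, the operation on sets dual to right multiplication by [p]. *)
Definition translate_set p A : set S := [set s | p [set t | A (s * t)%g]].

Lemma beta_mulE p q A : beta_mul p q A = p (translate_set q A).
Proof. by []. Qed.

Lemma translate_setI p A B : Filter p ->
  translate_set p (A `&` B) = translate_set p A `&` translate_set p B.
Proof.
move=> pF; apply/seteqP; split => s /=.
  by move=> ps; split; apply: filterS ps => t [].
by case; exact: filterI.
Qed.

Lemma translate_setC p A : UltraFilter p ->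
  translate_set p (~` A) = ~` translate_set p A.
Proof.
move=> pU; apply/seteqP; split => s /=; first exact: ultra_notin_setC.
by have [|] := in_ultra_setVsetC [set t | A (s * t)%g] pU.
Qed.

(* The nonempty closed subsets of the Stone-Cech compactification are the sets
   of ultrafilters refining a proper filter [G]; this says that the closed
   subset encoded by [G] is a subsemigroup. *)
Definition subsemigroup_filter G := ProperFilter G /\
  forall p q, UltraFilter p -> UltraFilter q -> G `<=` p -> G `<=` q ->
    G `<=` beta_mul p q.

(* Ultrafilters refining this filter are the [q] refining [G] with [qp = r]. *)
Definition divide_filter G p r : set_system S :=
  [set B | exists2 A, r A & G (~` translate_set p A `|` B)].

(** The last hypothesis puts [r] in the closed set of products [qp] with [q] refining [G]. Were the
    empty set a member, [r] would contain a set and its complement. *)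
Lemma divide_filter_proper G p r : Filter G -> UltraFilter p -> UltraFilter r ->
  [set A | G (translate_set p A)] `<=` r -> ProperFilter (divide_filter G p r).
Proof.
move=> GF pU rU Hr; apply: Build_ProperFilter.
  case=> A rA; rewrite setU0 -translate_setC // => GA.
  by apply: (ultra_notin_setC rU _ rA); exact: Hr.
split.
- by exists setT; [exact: filterT|rewrite setUT; exact: filterT].
- move=> B C [A rA GA] [A' rA' GA']; exists (A `&` A'); first exact: filterI.
  rewrite translate_setI //; apply: filterS2 GA GA' => x /=.
  have [xA|] := pselect (translate_set p A x); last by left=> -[].
  have [xA'|] := pselect (translate_set p A' x); last by left=> -[].
  by move=> [] // Bx [] // Cx; right.
- by move=> B C BC [A rA GA]; exists A => //; apply: filterS GA; exact: setUS.
Qed.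

Lemma sub_divide_filter G p r : Filter G -> Filter r ->
  G `<=` divide_filter G p r.
Proof.
move=> GF rF B GB; exists setT; first exact: filterT.
by apply: filterS GB => x; right.
Qed.

Lemma divide_filterP G p q r : Filter G ->
  UltraFilter p -> UltraFilter q -> UltraFilter r ->
  divide_filter G p r `<=` q <-> G `<=` q /\ beta_mul q p = r.
Proof.
move=> GF pU qU rU; split=> [Dq|[Gq <-] B [A qpA /Gq GA]].
  split; first by move=> B GB; apply: Dq; exact: sub_divide_filter GB.
  apply: max_filter; first exact: beta_mul_proper.
  move=> A rA; rewrite beta_mulE; apply: Dq; exists A => //.
  by rewrite setUC setUv; exact: filterT.
by apply: filterS2 GA qpA => x /= [].
Qed.

Lemma ex_beta_div G p r : Filter G -> UltraFilter p -> UltraFilter r ->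
  [set A | G (translate_set p A)] `<=` r ->
  exists q, [/\ UltraFilter q, G `<=` q & beta_mul q p = r].
Proof.
move=> GF pU rU Hr; have DP := divide_filter_proper GF pU rU Hr.
have [q [qU Dq]] := ultraFilterLemma DP.
by have [] := (divide_filterP GF pU qU rU).1 Dq; exists q.
Qed.

(** Larger filters encode smaller closed sets, so Zorn's lemma yields a minimal closed
    subsemigroup. *)
Lemma ex_maximal_subsemigroup_filter G0 : subsemigroup_filter G0 ->
  exists G, [/\ subsemigroup_filter G, G0 `<=` G &
    forall G', subsemigroup_filter G' -> G `<=` G' -> G' = G].
Proof.
move=> G0s.
(* The case [set0] covers the union of the empty chain; it is not maximal, since [G0] is larger. *)
pose P G := G = set0 \/ subsemigroup_filter G /\ G0 `<=` G.
have G0T : G0 setT by case: G0s => ? _; exact: filterT.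
have [C CP Ctot|G [PG Gmax]] := @Zorn_bigcup _ P.
  have [CT|nCT] := pselect ((\bigcup_(G in C) G) setT); last first.
    left; rewrite -subset0 => A [G CG GA]; apply: nCT; exists G => //.
    case: (CP _ CG) => [G_0|[[GP _] _]]; last exact: filterT.
    by move: GA; rewrite G_0.
  have Cs G A : C G -> G A -> subsemigroup_filter G /\ G0 `<=` G.
    by move=> CG GA; case: (CP _ CG) => // G_0; move: GA; rewrite G_0.
  right; split; last first.
    case: CT => G CG GT A G0A; exists G => //.
    by have [_] := Cs _ _ CG GT; exact.
  split=> [|p q pU qU Cp Cq A [G CG GA]].
    apply: Build_ProperFilter.
      case=> G CG G_0; have [[GP _] _] := Cs _ _ CG G_0.
      by have [] := filter_ex G_0.
    split=> // A B; last first.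
      move=> AB [G CG GA]; exists G => //.
      by have [[GP _] _] := Cs _ _ CG GA; exact: filterS GA.
    move=> [G CG GA] [G' CG' GB].
    have [[GP _] _] := Cs _ _ CG GA; have [[GP' _] _] := Cs _ _ CG' GB.
    have [GG'|GG'] := Ctot _ _ CG CG'.
      by exists G' => //; apply: filterI => //; exact: GG'.
    by exists G => //; apply: filterI => //; exact: GG'.
  have [[_ Gs] _] := Cs _ _ CG GA.
  by apply: Gs => // B GB; [apply: Cp|apply: Cq]; exists G.
case: PG => [G_0|[Gs G0G]].
  exfalso; apply: (Gmax G0); last by right; split.
  by rewrite G_0; split=> // /(_ _ G0T).
exists G; split=> // G' Gs' GG'; apply: contrapT => nE.
apply: (Gmax G'); last by right; split=> //; exact: subset_trans GG'.
by split=> // G'G; apply: nE; apply/seteqP.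
Qed.

(* Ellis-Numakura theorem *)
Lemma ex_idempotent_ultrafilter G0 : subsemigroup_filter G0 ->
  exists p, [/\ UltraFilter p, beta_mul p p = p & G0 `<=` p].
Proof.
move=> /ex_maximal_subsemigroup_filter[G [[GP Gs] G0G Gmax]].
have [p [pU Gp]] := ultraFilterLemma GP.
(* Let [T] be the minimal closed subsemigroup encoded by [G]. Then [H] encodes [Tp], a closed
   subsemigroup of [T], hence all of [T]. *)
pose H := [set A | G (translate_set p A)].
have GH : G `<=` H.
  move=> A GA; apply: (@filter_mem_ultra _ G) => q qU Gq.
  by rewrite -beta_mulE; exact: Gs.
have HE : H = G.
  apply: Gmax => //; split=> [|q r qU rU Hq Hr A HA].
    apply: Build_ProperFilter.
      rewrite /H /= (_ : translate_set p set0 = set0).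
        exact: filter_not_empty.
      by apply/seteqP; split=> // s /filter_ex[].
    split=> [|A B|A B AB]; first by apply: GH; exact: filterT.
      by rewrite /H /= translate_setI //; exact: filterI.
    by apply: (@filterS _ G) => s; apply: filterS => t; exact: AB.
  have [r' [r'U Gr' <-]] := ex_beta_div _ pU rU Hr.
  rewrite beta_mulA beta_mulE; apply: Gs => //.
  exact: subset_trans Hq.
have Hp : [set A | G (translate_set p A)] `<=` p by rewrite -/H HE.
(* As [p] lies in [Tp], the [q] in [T] with [qp = p] form a nonempty closed subsemigroup, hence all
   of [T]; so [q = p] is allowed. *)
have DE : divide_filter G p p = G.
  apply: Gmax; last exact: sub_divide_filter.
  split=> [|q r qU rU]; first exact: divide_filter_proper.
  move=> /(divide_filterP _ pU qU pU)[Gq qp].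
  move=> /(divide_filterP _ pU rU pU)[Gr rp].
  have qrU := beta_mul_ultra qU rU.
  apply/divide_filterP => //; split; first exact: Gs.
  by rewrite -beta_mulA rp qp.
have /(divide_filterP _ pU pU pU)[_ pp] : divide_filter G p p `<=` p.
  by rewrite DE.
by exists p; split=> //; exact: subset_trans Gp.
Qed.

End Ellis.

(** * Cardinalities of finite sets *)

Definition fcard (T : choiceType) (A : set T) : nat := #|` fset_set A|.

(** Finiteness of [B] matters: [fset_set] sends infinite sets to the empty one, so their [fcard] is
    0. *)
Lemma leq_fcard (T : choiceType) (A B : set T) :
  finite_set B -> A `<=` B -> (fcard A <= fcard B)%N.
Proof.
move=> Bfin AB; apply: fsubset_leq_card.
by rewrite -fset_set_sub //; exact: sub_finite_set Bfin.
Qed.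

Section Fcard.
Variables T U : choiceType.
Implicit Types (A B : set T).

Lemma leq_fcard_image (f : T -> U) A :
  finite_set A -> (fcard (f @` A) <= fcard A)%N.
Proof. by move=> Afin; rewrite /fcard fset_set_image // leq_imfset_card. Qed.

Lemma leq_fcard_inj (f : T -> U) A (B : set U) : finite_set A -> finite_set B ->
  (forall x y, A x -> A y -> f x = f y -> x = y) -> f @` A `<=` B ->
  (fcard A <= fcard B)%N.
Proof.
move=> Afin Bfin finj fAB; apply: leq_trans (leq_fcard Bfin fAB).
rewrite /fcard fset_set_image // card_in_imfset // => x y.
by rewrite !in_fset_set // !inE; exact: finj.
Qed.

Lemma fcardU A B : finite_set A -> finite_set B ->
  (fcard (A `|` B) <= fcard A + fcard B)%N.
Proof.
by move=> Afin Bfin; rewrite /fcard fset_setU // cardfsU leq_subr.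
Qed.

Lemma fcard_gt0 A : finite_set A -> A !=set0 -> (0 < fcard A)%N.
Proof.
move=> Afin [x Ax]; rewrite /fcard cardfs_gt0; apply/fset0Pn; exists x.
by rewrite in_fset_set // inE.
Qed.

End Fcard.

Lemma fcardX (T U : choiceType) (A : set T) (B : set U) :
  finite_set A -> finite_set B -> fcard (A `*` B) = (fcard A * fcard B)%N.
Proof.
move=> Afin Bfin; rewrite /fcard fset_setX //.
rewrite -(size_allpairs pair); apply: perm_size; apply: uniq_perm.
- exact: fset_uniq.
- by apply: allpairs_uniq => //; [exact: fset_uniq..|move=> [a b] [c d]].
- move=> [a b]; rewrite in_fsetM; apply/andP/allpairsP => /=.
    by case=> aA bB; exists (a, b).
  by case=> -[c d] /= [cA dB [-> ->]].
Qed.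

(** * Positive density and the right ideal it defines *)

Section Density.
Variables (R : realType) (S : semigroupType).
Implicit Types (F : Pf_net S) (A B : set S) (p q : set_system S).

Definition has_density F A (a : R) := forall i0 : F, exists2 i, nle i0 i &
  exists s, a * (fcard (nval i))%:R
    <= (fcard (A `&` rtranslate (nval i) s))%:R.

Definition pos_density F A := exists2 a : R, 0 < a & has_density F A a.

Lemma finite_nval F (i : F) : finite_set (nval i).
Proof. by case: (nval_Pf i). Qed.

Lemma fcard_nval_gt0 F (i : F) : (0 < fcard (nval i))%N.
Proof. by case: (nval_Pf i) => fin ne; exact: fcard_gt0. Qed.

Lemma finite_rtranslate E s : finite_set E -> finite_set (@rtranslate S E s).
Proof. by case: s => [t|] //=; exact: finite_image. Qed.

Lemma finite_rtranslateI A E s :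
  finite_set E -> finite_set (A `&` @rtranslate S E s).
Proof.
by move=> /finite_rtranslate Es; apply: sub_finite_set (Es s) => x [].
Qed.

Lemma fcard_rtranslate E s :
  finite_set E -> (fcard (@rtranslate S E s) <= fcard E)%N.
Proof. by case: s => [t|] //= Efin; exact: leq_fcard_image. Qed.

(** A positive supremum forces a positive member. Conversely, the set is bounded by 1, as
    translating a finite set does not enlarge it. *)
Lemma density_gt0P F A : 0 < upper_banach_density R F A <-> pos_density F A.
Proof.
split=> [/sup_gt[|a Fa a0]|[a a0 Fa]]; last 2 first.
- by exists a.
- apply: lt_le_trans a0 _; apply: ub_le_sup => //; exists 1 => b.
  have [i0] := nidx_inhabited F.
  move=> /(_ i0)[i _ [s]] /= ble.
  have Fi0 : 0 < (fcard (nval i))%:R :> R by rewrite ltr0n fcard_nval_gt0.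
  rewrite -(ler_pM2r Fi0) mul1r; apply: le_trans ble _; rewrite ler_nat.
  apply: leq_trans (fcard_rtranslate s (finite_nval i)).
  by apply: leq_fcard => [|x []//]; exact/finite_rtranslate/finite_nval.
- exists 0 => i0; exists i0; first exact: nle_refl.
  by exists None; rewrite mul0r ler0n.
Qed.

Lemma not_pos_density0 F : ~ pos_density F set0.
Proof.
move=> [a a0 Fa]; have [i0] := nidx_inhabited F.
have [i _ [s]] := Fa i0.
rewrite set0I /fcard fset_set0 cardfs0 leNgt mulr_gt0 //.
by rewrite ltr0n; exact: fcard_nval_gt0.
Qed.

Lemma pos_densityS F A B : A `<=` B -> pos_density F A -> pos_density F B.
Proof.
move=> AB [a a0 Fa]; exists a => // i0; have [i ii0 [s asi]] := Fa i0.
exists i => //; exists s; apply: le_trans asi _; rewrite ler_nat.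
apply: leq_fcard; first exact/finite_rtranslateI/finite_nval.
exact: setSI.
Qed.

(** If neither part had density [a / 2], then beyond a common index both would fill less than
    [a / 2] of every translate, and the union less than [a]. *)
Lemma pos_density_setU F A B :
  pos_density F (A `|` B) -> pos_density F A \/ pos_density F B.
Proof.
move=> [a a0 Fa]; apply: contrapT => /not_orP[nA nB].
have key C : ~ pos_density F C -> exists i0 : F, forall i s, nle i0 i ->
    (fcard (C `&` rtranslate (nval i) s))%:R
      < a / 2 * (fcard (nval i))%:R :> R.
  move=> nC; apply: contrapT => /forallNP nF; apply: nC; exists (a / 2).
    by rewrite divr_gt0.
  move=> i0; have /existsNP[i /existsNP[s]] := nF i0.
  by move=> /not_implyP[i0i /negP]; rewrite -leNgt; exists i => //; exists s.
have [iA FA] := key _ nA; have [iB FB] := key _ nB.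
have [k iAk iBk] := nle_directed iA iB.
have [i ki [s]] := Fa k.
have := FA i s (nle_trans iAk ki); have := FB i s (nle_trans iBk ki).
rewrite setIUl => ltB ltA leU.
have : (fcard (A `&` rtranslate (nval i) s `|` B `&` rtranslate (nval i) s)
  <= fcard (A `&` rtranslate (nval i) s)
    + fcard (B `&` rtranslate (nval i) s))%N.
  by apply: fcardU; exact/finite_rtranslateI/finite_nval.
rewrite -(ler_nat R) natrD; lra.
Qed.

(* Right translation by [t] is injective, so [D_star] is a right ideal. *)
Lemma pos_density_beta_mul F p q : right_cancellative S -> ProperFilter q ->
  (forall A, p A -> pos_density F A) ->
  forall A, beta_mul p q A -> pos_density F A.
Proof.
move=> rcS qP pF A /pF[a a0 Fa]; exists a => // i0.
have [i i0i [s asi]] := Fa i0; exists i => //.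
move: asi; set X := _ `&` _ => asi.
have Xfin : finite_set X by exact/finite_rtranslateI/finite_nval.
(* Each of the finitely many [x] in [X] gives a member of [q]; any [t] in their intersection
   works. *)
have [t Xt] : exists t, forall x, X x -> A (x * t)%g.
  have : q (\bigcap_(x in [set` fset_set X]) [set t | A (x * t)%g]).
    by apply: filter_bigI => x; rewrite in_fset_set // inE => -[].
  move=> /filter_ex[t Xt]; exists t => x Xx; apply: Xt.
  by rewrite /= in_fset_set // inE.
exists (Some (if s is Some u then u * t else t)%g).
apply: le_trans asi _; rewrite ler_nat.
apply: (@leq_fcard_inj _ _ (fun x => x * t)%g) => //.
- exact/finite_rtranslateI/finite_nval.
- by move=> x y _ _; exact: rcS.
- move=> _ [x Xx <-]; split; first exact: Xt.
  case: Xx => _; case: s {X Xfin Xt} => [u [y Fy <-]|Fx] /=.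
    by exists y; rewrite ?mulgA.
  by exists x.
Qed.

(* Its refining ultrafilters are those that refine [G] and consist of sets of
   positive density. *)
Definition density_filter F G : set_system S :=
  [set A | exists B N, [/\ G B, ~ pos_density F N & B `<=` A `|` N]].

(** Sets without positive density form an ideal by [pos_density_setU], and no member of [G] lies in
    it. *)
Lemma density_filter_proper F G : Filter G ->
  (forall A, G A -> pos_density F A) -> ProperFilter (density_filter F G).
Proof.
move=> GF Gd; apply: Build_ProperFilter.
  move=> [B [N [/Gd dB nN]]]; rewrite set0U => BN; apply: nN.
  exact: pos_densityS dB.
split.
- exists setT, set0; split; [exact: filterT| |by left].
  exact: not_pos_density0.
- move=> A A' [B [N [GB nN BAN]]] [B' [N' [GB' nN' BAN']]].
  exists (B `&` B'), (N `|` N'); split; first exact: filterI.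
    by case/pos_density_setU.
  move=> x [/BAN + /BAN']; case=> xA; last by right; left.
  by case=> xA'; [left|right; right].
- move=> A A' AA' [B [N [GB nN BAN]]]; exists B, N; split=> // x /BAN.
  by case=> [/AA'|]; [left|right].
Qed.

Lemma sub_density_filter F G : G `<=` density_filter F G.
Proof.
move=> A GA; exists A, set0; split; [by []| |by left].
exact: not_pos_density0.
Qed.

(** The complement of a set without positive density belongs to [density_filter F G]. *)
Lemma density_filter_pos F G p : Filter G -> UltraFilter p ->
  density_filter F G `<=` p -> forall A, p A -> pos_density F A.
Proof.
move=> GF pU Gp A pA; apply: contrapT => nA.
apply: (@ultra_notin_setC _ p A) => //; apply: Gp.
exists setT, A; split=> //; first exact: filterT.
by rewrite setUC setUv.
Qed.

(** A subsemigroup and a right ideal meet in a subsemigroup; the density of the members of [G] makes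
    it nonempty. *)
Lemma ex_D_star_idempotent F G : right_cancellative S ->
  subsemigroup_filter G -> (forall A, G A -> pos_density F A) ->
  exists p, [/\ beta p, beta_mul p p = p, D_star R F p & G `<=` p].
Proof.
move=> rcS [GP Gs] Gd; have GH := @sub_density_filter F G.
have : subsemigroup_filter (density_filter F G).
  split=> [|p q pU qU Hp Hq A [B [N [GB nN BAN]]]].
    exact: density_filter_proper.
  have pqU := beta_mul_ultra pU qU.
  have pqB : beta_mul p q B.
    by apply: Gs GB => //; exact: subset_trans GH _.
  (* If [A] is missing, the product contains [B] minus [A], hence [N], against the right ideal
     property. *)
  have [//|nA] := in_ultra_setVsetC A pqU.
  exfalso; apply: nN; apply: (pos_density_beta_mul (p := p) (q := q)) => //.
    exact: density_filter_pos Hp.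
  by apply: filterS2 pqB nA => x /BAN[].
move=> /ex_idempotent_ultrafilter[p [pU pp Hp]]; exists p; split=> //.
  by split=> // A pA; apply/density_gt0P; exact: (density_filter_pos _ _ Hp).
exact: subset_trans Hp.
Qed.

End Density.

(** * Counting points of a product under coordinatewise constraints *)

Section Product.
Variables (I : Type) (S : I -> monoidType).
Implicit Types (x y z : forall i, S i) (i k : I).

Definition update x i (g : S i) : forall k, S k := fun k =>
  if pselect (i = k) is left e then eq_rect i (fun k => S k : Type) g k e
  else x k.

Lemma updateE x i (g : S i) : update x g i = g.
Proof.
by rewrite /update; case: pselect => // e; rewrite (Prop_irrelevance e erefl).
Qed.

Lemma updateN x i (g : S i) k : i <> k -> update x g k = x k.
Proof. by rewrite /update; case: pselect. Qed.

(* Swapping the [i]-th coordinate of [z] with [y] is an injection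
   [(z, y) |-> (update z y, z i)]. *)
Lemma leq_fcard_coordinate (Z : set (forall i, S i)) i (X Y : set (S i)) :
  finite_set Z -> finite_set X -> Y `<=` X -> (forall z, Z z -> X (z i)) ->
  (forall z g, Z z -> X g -> Z (update z g)) ->
  (fcard Z * fcard Y <= fcard (Z `&` [set z | Y (z i)]) * fcard X)%N.
Proof.
move=> Zfin Xfin YX ZX ZU.
have Yfin : finite_set Y by exact: sub_finite_set Xfin.
have Zfin' : finite_set (Z `&` [set z | Y (z i)]).
  by apply: sub_finite_set Zfin => z [].
rewrite -!fcardX //.
apply: (@leq_fcard_inj _ _ (fun u => (update u.1 u.2, u.1 i))).
- exact: finite_setX.
- exact: finite_setX.
- move=> [z g] [w h] _ _ /= [zw zwi].
  have gh : g = h by rewrite -(updateE z g) -(updateE w h) zw.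
  congr (_, _) => //; apply: functional_extensionality_dep => k.
  have [<-//|ik] := pselect (i = k).
  by rewrite -(updateN z g ik) zw updateN.
- move=> _ [[z g] [/= Zz Yg] <-]; split=> /=; last exact: ZX.
  split; first by apply: ZU => //; exact: YX.
  by rewrite /= updateE.
Qed.

(** Constraints are imposed one coordinate at a time, each costing the factor [a i]. *)
Lemma leq_prod_fcard (R : realType) (X Y : forall i, set (S i)) (a : I -> R)
    (r : seq {classic I}) :
  finite_set [set x | forall i, X i (x i)] -> (forall i, Pf (X i)) ->
  (forall i, 0 <= a i) -> uniq r ->
  (forall i : I, (i : {classic I}) \in r -> Y i `<=` X i /\
    a i * (fcard (X i))%:R <= (fcard (Y i))%:R) ->
  (\prod_(i <- r) a i) * (fcard [set x | forall i, X i (x i)])%:R <=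
    (fcard [set x | (forall i, X i (x i)) /\
      forall i : I, (i : {classic I}) \in r -> Y i (x i)])%:R.
Proof.
move=> Pfin Xfin a0; elim: r => [_ _|i r IH /= /andP[ir ur] rY].
  by rewrite big_nil mul1r ler_nat; apply: leq_fcard => [|x Px //];
    apply: sub_finite_set Pfin => x [].
have {}IH := IH ur; move: IH; set Z := [set x | _ /\ _] => IH.
have /IH{IH} : forall i : I, (i : {classic I}) \in r -> Y i `<=` X i /\
    a i * (fcard (X i))%:R <= (fcard (Y i))%:R.
  by move=> k kr; apply: rY; rewrite inE kr orbT.
have [YX aY] := rY i (mem_head _ _).
set P := (fcard [set x | forall i, _])%:R => IH.
have Zfin : finite_set Z by apply: sub_finite_set Pfin => x [].
have Xi0 : 0 < (fcard (X i))%:R :> R.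
  by rewrite ltr0n; case: (Xfin i) => ? ?; exact: fcard_gt0.
have := @leq_fcard_coordinate Z i (X i) (Y i) Zfin (Xfin i).1 YX.
have ZX z : Z z -> X i (z i) by case.
(* As [i] is not in [r], the [i]-th coordinate in [Z] ranges freely over [X i]. *)
have ZU z g : Z z -> X i g -> Z (update z g).
  move=> [Xz Yz] Xg; split=> k.
    have [<-|ik] := pselect (i = k); first by rewrite updateE.
    by rewrite updateN.
  move=> kr; rewrite updateN; first exact: Yz.
  by move=> ik; move: ir; rewrite ik kr.
move=> /(_ ZX ZU) ZY.
rewrite big_cons -(ler_pM2r Xi0).
apply: (@le_trans _ _ ((fcard Z)%:R * (fcard (Y i))%:R)).
  have prod0 : 0 <= \prod_(k <- r) a k by apply: prodr_ge0.
  have -> : a i * (\prod_(k <- r) a k) * P * (fcard (X i))%:R =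
      (\prod_(k <- r) a k * P) * (a i * (fcard (X i))%:R) by ring.
  by apply: ler_pM => //; apply: mulr_ge0 => //; exact: ler0n.
rewrite -!natrM ler_nat; apply: leq_trans ZY _; rewrite leq_mul2r.
apply/orP; right; apply: leq_fcard => [|x [[Xx Yx] Yi]].
  by apply: sub_finite_set Pfin => x [].
split=> // k; rewrite inE => /orP[/eqP ->|] //; exact: Yx.
Qed.

End Product.

(** * Positive density of the basic sets of the product filter *)

Section ProductSets.
Variables (R : realType) (I : Type) (S : I -> monoidType).
Variable F : forall i, Pf_net (S i).

(** Allowing any finite [E] of left factors lets a further factor [s] be absorbed, by passing from
    [E] to [Es]. *)
Definition box (A : forall i, set (S i)) (K : set I) (b : forall i, set (S i))
    (E : set (forall i, S i)) : set (forall i, S i) :=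
  [set y | (forall i, K i -> b i (y i)) /\
    forall i, ~ K i -> forall x, E x -> A i (x i * y i)%g].

Lemma nval1_Pf i (j : option (F i)) : Pf (nval1 j).
Proof.
by case: j => [a|] /=; [exact: nval_Pf|split; [exact: finite_set1|exists 1%g]].
Qed.

(* Coordinates in [K] use the density of [b i], which may require enlarging the
   index; the other coordinates keep theirs, by thickness with density 1. *)
Lemma pos_density_box (A : forall i, set (S i)) (K : set I)
    (b : forall i, set (S i)) (E : set (forall i, S i)) :
  (forall i, right_cancellative (S i)) ->
  finite_set K -> (forall i, K i -> pos_density R (F i) (b i)) ->
  (forall i, ~ K i -> thick (A i)) -> finite_set E ->
  pos_density R (product_net F) (box A K b E).
Proof.
move=> rcS Kfin bd At Efin.
have aP i : exists a : R, 0 < a /\ (K i -> has_density (F i) (b i) a).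
  have [/bd[a a0 Fa]|nKi] := pselect (K i); first by exists a.
  by exists 1.
have [a {}aP] : exists a : I -> R, forall i,
    0 < a i /\ (K i -> has_density (F i) (b i) (a i)).
  by exists (fun i => sval (cid (aP i))) => i; exact: svalP (cid (aP i)).
have [r ur Kr] : exists2 r : seq {classic I}, uniq r &
    forall i : I, (i : {classic I}) \in r <-> K i.
  have /(@finite_seqP {classic I})[r Kr] := Kfin.
  exists (undup r); first exact: undup_uniq.
  by move=> i; rewrite mem_undup Kr.
(* Only coordinates in [K] contribute; the others have relative density 1. *)
exists (\prod_(i <- r) a i); first by apply: prodr_gt0 => i _; case: (aP i).
move=> j0.
have ksP i : exists u : option (F i) * S i,
    [/\ nle1 (sval j0 i) u.1, u.1 <> None -> K i \/ sval j0 i <> None,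
    K i -> a i * (fcard (nval1 u.1))%:R <=
      (fcard (nval1 u.1 `&` [set x | b i (x * u.2)%g]))%:R &
    ~ K i -> forall x f, E x -> nval1 u.1 f -> A i (x i * (f * u.2))%g].
  have [Ki|nKi] := pselect (K i).
    have [_ /(_ Ki) Fa] := aP i.
    (* The density of [b i] concerns genuine indices only, so the added point [None] is first
       replaced by one. *)
    have [k0 k0P] : exists k0 : F i, nle1 (sval j0 i) (Some k0).
      case: (sval j0 i) => [k|]; first by exists k; exact: nle_refl.
      by have [k] := nidx_inhabited (F i); exists k.
    have [k k0k [s aks]] := Fa k0.
    exists (Some k, if s is Some t then t else 1%g); split=> //.
    - case: (sval j0 i) k0P => //= l lk0; exact: nle_trans k0k.
    - by left.
    - move=> _; apply: le_trans aks _; rewrite ler_nat /=.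
      have kfin := finite_nval k.
      (* Points of [b i] in the translate are images, under right multiplication, of the points
         counted on the right. *)
      apply: (leq_trans _ (leq_fcard_image
        (fun x => x * (if s is Some t then t else 1))%g _)); last first.
        by apply: sub_finite_set kfin => x [].
      apply: leq_fcard.
        by apply: finite_image; apply: sub_finite_set kfin => x [].
      case: s => [t|] x [bx] /=.
        by move=> [y ky yx]; exists y => //; split=> //=; rewrite yx.
      by move=> kx; exists x; rewrite ?mulg1 //; split=> //=; rewrite mulg1.
  have [kfin [f0 kf0]] := nval1_Pf (sval j0 i).
  (* Thickness applies to the finite set of products [x i * f]; adjoining 1 keeps it nonempty when
     [E] is empty. *)
  have [|s sA] := At i nKi
      [set (x i * f)%g | x in E `|` [set 1%g] & f in nval1 (sval j0 i)].
    split; last by exists (1 * f0)%g, 1%g; [right|exists f0].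
    by apply: finite_image2 => //; rewrite finite_setU; split.
  exists (sval j0 i, s); split=> //=.
  - by case: (sval j0 i) => //= l; exact: nle_refl.
  - by right.
  - move=> _ x f Ex kf; rewrite mulgA; apply: sA.
    by exists (x i * f)%g => //; exists x; [left|exists f].
have [k [s /all_and4[j0k kfin Ks nKs]]] : exists (k : forall i, option (F i))
    (s : forall i, S i), forall i,
    [/\ nle1 (sval j0 i) (k i), k i <> None -> K i \/ sval j0 i <> None,
    K i -> a i * (fcard (nval1 (k i)))%:R <=
      (fcard (nval1 (k i) `&` [set x | b i (x * s i)%g]))%:R &
    ~ K i -> forall x f, E x -> nval1 (k i) f -> A i (x i * (f * s i))%g].
  exists (fun i => (sval (cid (ksP i))).1), (fun i => (sval (cid (ksP i))).2).
  by move=> i; exact: svalP (cid (ksP i)).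
(* Enlarging indices only on the finite set [K] keeps the support finite. *)
have {}kfin : finite_set [set i | k i <> None].
  apply: (@sub_finite_set _ _ (K `|` [set i | sval j0 i <> None])).
    by move=> i /kfin.
  by rewrite finite_setU; split=> //; exact: (svalP j0).
pose j : prod_idx F := exist _ k kfin.
exists (j : product_net F) => //; exists (Some (s : forall i, S i)).
have Pfin : finite_set [set x : forall i, S i | forall i, nval1 (k i) (x i)].
  exact: (prod_nval_Pf j).1.
have a0 i : 0 <= a i by apply: ltW; case: (aP i).
apply: le_trans (leq_prod_fcard
  (Y := fun i => nval1 (k i) `&` [set x | b i (x * s i)%g])
  Pfin (fun i => nval1_Pf (k i)) a0 ur _) _.
  by move=> i /Kr Ki; split; [move=> x []|exact: Ks].
rewrite ler_nat.
apply: (@leq_fcard_inj _ _ (fun x => x * s)%g).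
- by apply: sub_finite_set Pfin => x [].
- exact/finite_rtranslateI/finite_nval.
- move=> x y _ _ xy; apply: functional_extensionality_dep => i.
  by apply: (rcS i _ _ (s i)); exact: (congr1 (fun z => z i) xy).
- move=> _ [x [kx bx] <-]; split; last by exists x.
  split=> i; first by move=> /Kr/bx[].
  by move=> nKi z Ez; apply: nKs.
Qed.

End ProductSets.

(** * The filter generated by the boxes, and an idempotent refining it *)

Theorem theorem5p18 (R : realType) (I : Type) (S : I -> monoidType)
    (F : forall i, Pf_net (S i)) (A : forall i, set (S i)) :
  infinite_set [set: I] ->
  (forall i, right_cancellative (S i)) ->
  (forall i, D_set R (F i) (A i)) ->
  finite_set [set i | ~ thick (A i)] ->
  D_set R (product_net F) [set x | forall i, A i (x i)].
Proof.
move=> _ rcS DA; set K := [set i | _] => Kfin.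
have [p pP] : exists p : forall i, set_system (S i), forall i,
    [/\ beta (p i), beta_mul (p i) (p i) = p i, D_star R (F i) (p i) &
      p i (A i)].
  exists (fun i => sval (cid (DA i))) => i; exact: svalP (cid (DA i)).
have {pP} [pU pp pD pA] := all_and4 pP.
have pF i : ProperFilter (p i) by case: (pU i).
have nKthick i : ~ K i -> thick (A i) by move/contrapT.
pose G : set_system (forall i, S i) := [set X | exists b E,
  [/\ forall i, K i -> p i (b i), finite_set E & box A K b E `<=` X]].
have Gbox b E : (forall i, K i -> p i (b i)) -> finite_set E -> G (box A K b E).
  by exists b, E; split.
have Gdens X : G X -> pos_density R (product_net F) X.
  move=> [b [E [pb Efin bEX]]]; apply: pos_densityS bEX _.
  apply: pos_density_box => // i Ki; apply/density_gt0P.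
  by case: (pD i) => _; apply; exact: pb.
have GP : ProperFilter G.
  apply: Build_ProperFilter; first by move/Gdens/not_pos_density0.
  split=> [|X Y [b [E [pb Efin bEX]]] [b' [E' [pb' Efin' bEY]]]|X Y XY].
  - by exists (fun=> setT), set0; split=> // i _ /=; exact: filterT.
  - exists (fun i => b i `&` b' i), (E `|` E'); split.
    + by move=> i Ki; apply: filterI; [exact: pb|exact: pb'].
    + by rewrite finite_setU.
    + move=> y [by_ Ey]; split; [apply: bEX|apply: bEY]; split=> i Ki.
      * by case: (by_ i Ki).
      * by move=> x Ex; apply: Ey => //; left.
      * by case: (by_ i Ki).
      * by move=> x Ex; apply: Ey => //; right.
  - move=> [b [E [pb Efin bEX]]]; exists b, E; split=> //.
    exact: subset_trans XY.
have Gs : subsemigroup_filter G.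
  split=> // q r qU rU Gq Gr X [b [E [pb Efin bEX]]].
  apply: (@filterS _ _ (beta_mul_proper _ _) _ _ bEX).
  (* Since [p i] is idempotent, the translate set of [b i] is again a member of [p i]. *)
  have : q (box A K (fun i => translate_set (p i) (b i)) E).
    apply: Gq; apply: Gbox => // i Ki.
    by rewrite -beta_mulE pp; exact: pb.
  apply: (@filterS _ q) => s [bs Es] /=.
  (* With [s] fixed, the set of left factors becomes [Es]; the condition off [K] rests on [r]
     alone. *)
  have : r (box A K (fun i => [set t | b i (s i * t)%g])
      [set (x * s)%g | x in E]).
    by apply: Gr; apply: Gbox => //; exact: finite_image.
  apply: (@filterS _ r) => t [bt Et]; split=> i Ki; first exact: bt.
  by move=> x Ex; rewrite mulgA; apply: (Et i Ki (x * s)%g); exists x.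
have rc : right_cancellative (forall i, S i).
  move=> x y z xyz; apply: functional_extensionality_dep => i.
  by apply: (rcS i _ _ (z i)); exact: (congr1 (fun u => u i) xyz).
have [q [qU qq qD Gq]] := ex_D_star_idempotent rc Gs Gdens.
exists q; split=> //; apply: Gq; exists A, [set 1%g]; split=> //.
move=> y [Ay Ey] i; have [|nKi] := pselect (K i); first exact: Ay.
by have := Ey i nKi 1%g erefl; rewrite mul1g.
Qed.
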